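(* Let $1\le p<+\infty$. The sequence classes $\ell_p^w(\cdot)$ and $\ell_p^u(\cdot)$ are multilinearly stable if and only if $p=1$. (That is, each of the two classes is multilinearly stable if and only if $p=1$.)
   Context: All Banach spaces are over a fixed field $\mathbb{K}=\mathbb{R}$ or $\mathbb{C}$; $B_{E'}$ is the closed unit ball of the topological dual $E'$ of $E$. $\mathcal{L}(E_1,\ldots,E_n;F)$ is the Banach space of continuous $n$-linear operators $E_1\times\cdots\times E_n\to F$ with the usual sup norm. For a Banach space $E$ and $1\le p<\infty$: - $\ell_p^w(E)$ is the Banach space of weakly $p$-summable $E$-valued sequences, i.e. sequences $(x_j)_{j=1}^\infty$ with $(\varphi(x_j))_j\in\ell_p$ for all $\varphi\in E'$, with norm $\|(x_j)_{j=1}^\infty\|_{w,p}=\sup_{\varphi\in B_{E'}}\|(\varphi(x_j))_{j=1}^\infty\|_p$. - $\ell_p^u(E)=\{(x_j)_{j=1}^\infty\in\ell_p^w(E):\lim_k\|(x_j)_{j=k}^\infty\|_{w,p}=0\}$ with the norm inherited from $\ell_p^w(E)$. A sequence class $X$ is a rule assigning to each Banach space $E$ a Banach space $X(E)$ of $E$-valued sequences containing all finite sequences, contained in the bounded sequences with sup norm $\le\|\cdot\|_{X(E)}$, and with canonical scalar unit sequences of norm one in $X(\mathbb{K})$; the rules $E\mapsto\ell_p^w(E)$ and $E\mapsto\ell_p^u(E)$ are sequence classes. A sequence class $X$ is multilinearly stable if for every $n\in\mathbb{N}$, all Banach spaces $E_1,\ldots,E_n,F$ and every $A\in\mathcal{L}(E_1,\ldots,E_n;F)$,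 one has $(A(x_j^1,\ldots,x_j^n))_{j=1}^\infty\in X(F)$ whenever $(x_j^m)_{j=1}^\infty\in X(E_m)$, $m=1,\ldots,n$, and the induced $n$-linear operator $\widehat A\colon X(E_1)\times\cdots\times X(E_n)\to X(F)$, $\widehat A((x_j^1)_j,\ldots,(x_j^n)_j)=(A(x_j^1,\ldots,x_j^n))_j$, satisfies $\|\widehat A\|=\|A\|$. *)

(* Defs.v *)
From HB Require Import structures.
From mathcomp Require Import all_boot all_order all_algebra.
From mathcomp Require Import complex.
From mathcomp Require Import all_classical all_reals all_analysis.

Set Implicit Arguments.
Unset Strict Implicit.
Unset Printing Implicit Defensive.

Import Order.TTheory GRing.Theory Num.Theory.
Import numFieldNormedType.Exports.

Local Open Scope classical_set_scope.
Local Open Scope ring_scope.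

(* [scalar_field re] says that K is R or C = R[i].  Norms in a normed module
   over K take their values in K itself (on the nonnegative real axis when
   K = C); [re] is the real part, used to read them in R. *)
Variant scalar_field (R : realType) :
    forall K : numFieldType, (K -> R) -> Prop :=
  | scalar_field_real : @scalar_field R R (fun x => x)
  | scalar_field_complex : @scalar_field R R[i] (@complex.Re R).

Section SequenceClasses.
Context {R : realType} {K : numFieldType}.
Variable re : K -> R.

Definition rnorm (E : normedModType K) (x : E) : \bar R := (re `|x|)%:E.

Definition in_dual (E : normedModType K) (phi : {linear E -> K^o}) : Prop :=
  continuous phi.

Definition dual_norm (E : normedModType K) (phi : {linear E -> K^o}) : \bar R :=
  ereal_sup [set rnorm (phi x) | x in [set x : E | (rnorm x <= 1)%E]].

Definition multilinear n (E : 'I_n -> lmodType K) (F : lmodType K)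
    (A : (forall m, E m) -> F) : Prop :=
  forall (x : forall m, E m) (m : 'I_n) (a : K) (u v : E m),
    A (dfwith x m (a *: u + v)) = a *: A (dfwith x m u) + A (dfwith x m v).

(* The space L(E_1, ..., E_n; F); [prod_topology E] is the type
   [forall m, E m] equipped with the product topology. *)
Definition cont_multilinear n (E : 'I_n -> normedModType K)
    (F : normedModType K) (A : (forall m, E m) -> F) : Prop :=
  multilinear A /\ continuous (A : prod_topology E -> F).

Definition multilinear_norm n (E : 'I_n -> normedModType K)
    (F : normedModType K) (A : (forall m, E m) -> F) : \bar R :=
  ereal_sup [set rnorm (A x) |
    x in [set x : forall m, E m | forall m, (rnorm (x m) <= 1)%E]].

(* The data of a sequence class: the members of X(E) and their norms.  Stability
   refers to these only, so the sequence-class axioms are not bundled.  The norm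
   is extended-real-valued and meaningful on [seq_mem E] only. *)
Record seq_rule := SeqRule {
  seq_mem : forall E : completeNormedModType K, set (nat -> E) ;
  seq_norm : forall E : completeNormedModType K, (nat -> E) -> \bar R }.

Definition induced n (E : 'I_n -> completeNormedModType K)
    (F : completeNormedModType K) (A : (forall m, E m) -> F)
    (x : forall m, nat -> E m) : nat -> F :=
  fun j => A (fun m => x m j).

Definition induced_norm (X : seq_rule) n (E : 'I_n -> completeNormedModType K)
    (F : completeNormedModType K) (A : (forall m, E m) -> F) : \bar R :=
  ereal_sup [set seq_norm X (induced A x) |
    x in [set x : forall m, nat -> E m |
          forall m, seq_mem X (x m) /\ (seq_norm X (x m) <= 1)%E]].

Definition multilinearly_stable (X : seq_rule) : Prop :=
  forall (n : nat) (E : 'I_n -> completeNormedModType K)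
    (F : completeNormedModType K) (A : (forall m, E m) -> F),
    (0 < n)%N -> cont_multilinear A ->
    (forall x : forall m, nat -> E m,
       (forall m, seq_mem X (x m)) -> seq_mem X (induced A x)) /\
    induced_norm X A = multilinear_norm A.

Definition lp_norm (p : R) (a : nat -> K^o) : \bar R :=
  Lnorm counting p%:E (fun j => rnorm (a j)).

Definition in_lp (p : R) (a : nat -> K^o) : Prop := (lp_norm p a < +oo)%E.

Definition weak_norm (p : R) (E : normedModType K) (x : nat -> E) : \bar R :=
  ereal_sup [set lp_norm p (fun j => phi (x j)) |
    phi in [set phi : {linear E -> K^o} |
            in_dual phi /\ (dual_norm phi <= 1)%E]].

Definition weakly_summable (p : R) (E : normedModType K) : set (nat -> E) :=
  [set x | forall phi : {linear E -> K^o},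
             in_dual phi -> in_lp p (fun j => phi (x j))].

Definition lpw (p : R) : seq_rule :=
  SeqRule (fun E => @weakly_summable p E) (fun E => @weak_norm p E).

Definition lpu (p : R) : seq_rule :=
  SeqRule
    (fun E => [set x : nat -> E | weakly_summable p x /\
       weak_norm p (fun j => x (k + j)%N) @[k --> \oo] --> 0%E])
    (fun E => @weak_norm p E).

End SequenceClasses.

(* Main.v *)
From HB Require Import structures.
Require Import Defs.
From mathcomp Require Import all_boot all_order all_algebra.
From mathcomp Require Import complex.
From mathcomp Require Import all_classical all_reals all_analysis.
From mathcomp Require Import ring lra.

Set Implicit Arguments.
Unset Strict Implicit.
Unset Printing Implicit Defensive.

Import Order.TTheory GRing.Theory Num.Theory.
Import numFieldNormedType.Exports.

Local Open Scope classical_set_scope.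
Local Open Scope ring_scope.

(** A class is stable only if the norm of the induced operator never exceeds
    that of the operator, so both directions are about one inequality:
    the weak p-norm of (A(x_j^1, ..., x_j^n))_j is at most the norm of A times
    the product of the weak p-norms of the sequences x^m.

    For p = 1 it holds.  Test the left-hand side on a functional phi of norm
    at most 1 and absorb the phases of the numbers phi(A(x_j)) into the first
    argument; it remains to bound a diagonal sum sum_(j < N) B(x_j^1, ..., x_j^n)
    for the n-linear form B = phi o A.  Such a sum is an average of values
    B(sum_j e_j1 x_j^1, ..., sum_j e_jn x_j^n) over signs e ([polarization]), and
    a sum of unimodular multiples of the x_j has norm at most the weak 1-norm of
    the sequence, since the norm of a vector is attained by a functional.  Two
    classical theorems enter.  The Hahn-Banach theorem ([hahn_banach], by
    Zorn's lemma) provides the norming functionals.  The uniform boundedness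
    principle ([weakly_bounded], by a gliding hump) shows that a weakly summable
    sequence has a finite weak norm, which gives stability of the membership.
    Applied to tails, the inequality gives the case of l_1^u; sequences with a
    single nonzero entry show that the induced operator has norm at least that
    of A.

    For p > 1 it fails for the scalar product A of the two-dimensional Euclidean
    space, which has norm 1.  A functional of norm at most 1 takes values of
    moduli s and t with s^2 + t^2 <= 1 at the basis vectors e_1 and e_2, and then
    (s^p + t^p)^2 <= 1 + 2^(1 - p) < 2 ([sum_powR_sqr_le]).  Hence the
    weak p-norm W of (e_1, e_2) satisfies W^(2p) < 2, while A(e_j, e_j) = 1
    gives a sequence whose p-norm to the power p is 2.  All sequences involved
    have two nonzero terms, so l_p^w and l_p^u are refuted together.

    The two scalar fields are treated at once: everything uses only the
    properties collected in [real_scalars]. *)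

(** * The scalar field *)

(** What the real and the complex field share: [c] embeds R as the real
    scalars and [re] is the real part.  The scalar-linear functional asked for
    by [complexify] is f itself over R, and f(x) - i f(i x) over C. *)
Record real_scalars (R : realType) (K : numFieldType) (re : K -> R)
    (c : {rmorphism R -> K}) : Prop := RealScalars {
  reD : forall x y : K, re (x + y) = re x + re y ;
  reM : forall r x, re (c r * x) = r * re x ;
  re1 : re 1 = 1 ;
  re_normK : forall x : K, c (re `|x|) = `|x| ;
  norm_c : forall r : R, `|c r| = c `|r| ;
  re_le_norm : forall x : K, re x <= re `|x| ;
  complexify : forall (E : lmodType K) (f : E -> R),
    (forall x y, f (x + y) = f x + f y) -> (forall r x, f (c r *: x) = r * f x) ->
    exists phi : {linear E -> K^o}, forall x, re (phi x) = f x ;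
  complete_scalars : forall F : set_system K,
    ProperFilter F -> cauchy F -> cvg F }.

Section Instances.
Variable R : realType.

Lemma real_scalars_R : @real_scalars R R (fun x => x) idfun.
Proof.
split => //=; first exact: ler_norm.
  move=> E f fD fZ.
  have fL : linear (f : E -> R^o) by move=> a u v; rewrite fD fZ.
  pose fl := GRing.isLinear.Build R E R^o *:%R f fL.
  pose phi : {linear E -> R^o} := HB.pack f fl.
  by exists phi.
by move=> F FF; exact: (@cauchy_cvg R).
Qed.

Lemma norm_Re_le (z : R[i]) : `|complex.Re z| <= complex.Re `|z|.
Proof.
case: z => a b; rewrite normc_def /=.
by rewrite -sqrtr_sqr ler_wsqrtr// lerDl sqr_ge0.
Qed.

Lemma norm_Im_le (z : R[i]) : `|complex.Im z| <= complex.Re `|z|.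
Proof.
case: z => a b; rewrite normc_def /=.
by rewrite -sqrtr_sqr ler_wsqrtr// lerDr sqr_ge0.
Qed.

Lemma norm_le_ReIm (z : R[i]) :
  complex.Re `|z| <= `|complex.Re z| + `|complex.Im z|.
Proof.
case: z => a b; rewrite normc_def /=.
rewrite -[leRHS]ger0_norm ?addr_ge0// -sqrtr_sqr ler_wsqrtr// sqrrD.
by rewrite !real_normK ?num_real// lerD2r lerDl mulrn_wge0// mulr_ge0.
Qed.

Lemma lt_normC (z : R[i]) (e : R) : (`|z| < real_complex R e) = (complex.Re `|z| < e).
Proof. by rewrite normc_def ltcR. Qed.

(* The uniform structure is attached to numFieldType, not to the head symbol
   [complex]. *)
Let C : numFieldType := R[i].

Lemma complex_complete (F : set_system C) :
  ProperFilter F -> cauchy F -> cvg F.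
Proof.
move=> FF /cauchy_ballP Fc.
have part (g : C -> R) : (forall x y, g (x - y) = g x - g y) ->
    (forall z, `|g z| <= complex.Re `|z|) -> cvg (g @ F).
  move=> gB gle; apply: (@cauchy_cvg R); apply/cauchy_ballP => e e0.
  have ec : 0 < real_complex R e by rewrite ltcR.
  rewrite near_map2; have := Fc _ ec; apply: filterS => -[x y] /=.
  rewrite -!ball_normE /= lt_normC => h.
  by rewrite -gB (le_lt_trans (gle _)).
have /cvg_ex[a /cvgrPdist_lt ha] : cvg (@complex.Re R @ F).
  by apply: part; [case=> ? ? [] | exact: norm_Re_le].
have /cvg_ex[b /cvgrPdist_lt hb] : cvg (@complex.Im R @ F).
  by apply: part; [case=> ? ? [] | exact: norm_Im_le].
apply/cvg_ex; exists (Complex a b); apply/cvgrPdist_lt => e.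
case: e => e e' /=; rewrite ltcE /= => /andP[/eqP -> e0].
have e2 : 0 < e / 2 by rewrite divr_gt0.
have ReB w : complex.Re (Complex a b - w) = a - complex.Re w by case: w.
have ImB w : complex.Im (Complex a b - w) = b - complex.Im w by case: w.
near=> z; rewrite lt_normC (le_lt_trans (norm_le_ReIm _))// ReB ImB.
by rewrite (splitr e) ltrD//; near: z; [exact: ha _ e2 | exact: hb _ e2].
Unshelve. all: by end_near. Qed.

Lemma real_scalars_C : @real_scalars R R[i] (@complex.Re R) (real_complex R).
Proof.
split => /=.
- by case=> ? ? [].
- by move=> r [a b] /=; rewrite mul0r subr0.
- by [].
- by case=> a b.
- by move=> r; rewrite normc_def /= expr0n addr0 sqrtr_sqr.
- by move=> x; exact: le_trans (ler_norm _) (norm_Re_le _).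
- move=> E f fD fZ.
  pose g (x : E) : R[i]^o := Complex (f x) (- f (Complex 0 1 *: x)).
  have gL : linear g.
    move=> [a b] u v.
    have sE (w : E) : Complex a b *: w =
        real_complex R a *: w + real_complex R b *: (Complex 0 1 *: w).
      rewrite scalerA -scalerDl; congr (_ *: _).
      by apply/eqP; rewrite eq_complex /= !(mul0r,mulr0,mulr1,subr0,addr0,add0r) !eqxx.
    rewrite /g scalerDr !fD; apply/eqP; rewrite eq_complex /=.
    rewrite (sE u) fD !fZ scalerDr fD [Complex 0 1 *: (real_complex _ _ *: _)]scalerA.
    rewrite [Complex 0 1 *: (real_complex _ b *: _)]scalerA.
    rewrite ![Complex 0 1 * real_complex _ _]mulrC -!scalerA !fZ.
    rewrite [Complex 0 1 *: (Complex 0 1 *: u)]scalerA.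
    have -> : Complex 0 1 * Complex 0 1 = real_complex R (-1).
      by apply/eqP; rewrite eq_complex /=;
        rewrite !(mul0r,mulr0,mulr1,subr0,addr0,add0r,sub0r) !eqxx.
    by rewrite fZ; apply/andP; split; apply/eqP; ring.
  pose gl := GRing.isLinear.Build R[i] E R[i]^o *:%R g gL.
  pose phi : {linear E -> R[i]^o} := HB.pack g gl.
  by exists phi.
- exact: complex_complete.
Qed.

End Instances.

Lemma scalar_field_real_scalars (R : realType) (K : numFieldType) (re : K -> R) :
  scalar_field re -> exists c, real_scalars re c.
Proof.
case; first by exists idfun; exact: real_scalars_R.
by exists (real_complex R); exact: real_scalars_C.
Qed.

(** * The Hahn-Banach theorem *)

Section HahnBanach.
Context {R : realType} {V : lmodType R} (p : V -> R).
Hypothesis pD : forall x y, p (x + y) <= p x + p y.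
Hypothesis pZ : forall (r : R) x, 0 <= r -> p (r *: x) = r * p x.

(** Partial functionals are handled as graphs, so that the union of a chain is
    a plain union of sets.  Single-valuedness follows from linearity and
    domination by [p], see [dominated_graph_fun]. *)
Definition dominated_graph (G : set (V * R)) : Prop :=
  (forall r u v, G u -> G v -> G (r *: u.1 + v.1, r * u.2 + v.2)) /\
  (forall u, G u -> u.2 <= p u.1).

Let p0 : p 0 = 0. Proof. by rewrite -(scale0r 0) pZ// mul0r. Qed.

Lemma dominated_graph_fun G x a b :
  dominated_graph G -> G (x, a) -> G (x, b) -> a = b.
Proof.
move=> [GL Gp] Ga Gb; apply/eqP; rewrite eq_le; apply/andP; split.
- have := Gp _ (GL (-1) _ _ Gb Ga).
  by rewrite /= scaleN1r addNr p0 mulN1r addrC subr_le0.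
- have := Gp _ (GL (-1) _ _ Ga Gb).
  by rewrite /= scaleN1r addNr p0 mulN1r addrC subr_le0.
Qed.

(** The value [a] at the new vector [z] must satisfy
    u.2 - p (u.1 - z) <= a <= p (v.1 + z) - v.2 for all [u] and [v] in the graph;
    subadditivity of [p] puts every lower bound below every upper bound, and [a] is
    the supremum of the lower ones. *)
Lemma dominated_graph_extend G z : G !=set0 -> dominated_graph G ->
  exists G', [/\ dominated_graph G', G `<=` G' & exists a, G' (z, a)].
Proof.
move=> [g0 Gg0] [GL Gp].
have G00 : G (0, 0).
  by have := GL (-1) _ _ Gg0 Gg0; rewrite scaleN1r mulN1r !addNr.
have GZ r u : G u -> G (r *: u.1, r * u.2).
  by move=> Gu; have := GL r _ _ Gu G00; rewrite /= !addr0.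
pose S := [set u.2 - p (u.1 - z) | u in G].
have Sub u v : G u -> G v -> u.2 - p (u.1 - z) <= p (v.1 + z) - v.2.
  move=> Gu Gv; rewrite lerBlDr addrAC lerBrDr.
  have := Gp _ (GL 1 _ _ Gu Gv); rewrite /= scale1r mul1r => /le_trans; apply.
  by rewrite (le_trans _ (pD _ _))// addrACA subrr addr0 [v.1 + u.1]addrC.
have supS : has_sup S.
  split; first by exists (0 - p (0 - z)); exists (0, 0).
  by exists (p (0 + z) - 0) => _ [u Gu <-]; exact: Sub Gu G00.
pose a := sup S.
have a_ge u : G u -> u.2 - p (u.1 - z) <= a.
  by move=> Gu; apply: ub_le_sup; [case: supS | exists u].
have a_le v : G v -> a <= p (v.1 + z) - v.2.
  by move=> Gv; apply: ge_sup; [case: supS | move=> _ [u Gu <-]; exact: Sub].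
pose G' := [set w | exists u t, G u /\ w = (u.1 + t *: z, u.2 + t * a)].
exists G'; split.
- split.
  + move=> r _ _ [u [t [Gu ->]]] [v [s [Gv ->]]] /=.
    exists (r *: u.1 + v.1, r * u.2 + v.2), (r * t + s); split; first exact: GL.
    congr (_, _) => /=; last by ring.
    by rewrite scalerDr scalerA addrACA scalerDl.
  + move=> _ [u [t [Gu ->]]] /=.
    have [t0|t0|->] := ltgtP t 0; last first.
    * by rewrite scale0r mul0r !addr0; exact: Gp.
    * have := a_le _ (GZ t^-1 _ Gu); rewrite /= -(ler_pM2l t0) mulrBr mulrA.
      rewrite mulfV ?gt_eqF// mul1r -(pZ _ (ltW t0)) scalerDr scalerA.
      by rewrite mulfV ?gt_eqF// scale1r lerBrDr addrC.
    * have nt0 : 0 < - t by rewrite oppr_gt0.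
      have := a_ge _ (GZ (- t)^-1 _ Gu); rewrite /= -(ler_pM2l nt0) mulrBr mulrA.
      rewrite mulfV ?gt_eqF// mul1r -(pZ _ (ltW nt0)) scalerBr scalerA.
      by rewrite mulfV ?gt_eqF// scale1r scaleNr opprK mulNr; lra.
- by move=> u Gu; exists u, 0; split=> //; rewrite scale0r mul0r !addr0; case: u Gu.
- by exists a, (0, 0), 1; split=> //=; rewrite scale1r mul1r !add0r.
Qed.

Theorem hahn_banach G : G !=set0 -> dominated_graph G ->
  exists f : {linear V -> R^o},
    (forall u, G u -> f u.1 = u.2) /\ (forall x, f x <= p x).
Proof.
move=> [g Gg] domG.
(* Joining [G] to the members keeps the empty chain admissible. *)
pose P := [set H | dominated_graph (G `|` H)].
have [F FP Ftot|M [domM Mmax]] := @Zorn_bigcup _ P.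
  have common u v : (G `|` \bigcup_(H in F) H) u -> (G `|` \bigcup_(H in F) H) v ->
      exists H, [/\ H = set0 \/ F H, (G `|` H) u & (G `|` H) v].
    move=> [Gu|[H1 F1 H1u]] [Gv|[H2 F2 H2v]].
    - by exists set0; split; left.
    - by exists H2; split; [right|left|right].
    - by exists H1; split; [right|right|left].
    - have [h|h] := Ftot _ _ F1 F2.
        by exists H2; split; right=> //; exact: h.
      by exists H1; split; right=> //; exact: h.
  have domH H : H = set0 \/ F H -> dominated_graph (G `|` H).
    by move=> [->|/FP//]; rewrite setU0.
  have sub H : H = set0 \/ F H -> G `|` H `<=` G `|` \bigcup_(H in F) H.
    move=> [->|FH]; first by rewrite setU0; exact: subsetUl.
    by apply: setUS; exact: bigcup_sup.
  split=> [r u v Nu Nv|u Nu].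
    have [H [FH Hu Hv]] := common _ _ Nu Nv.
    by have [HL _] := domH _ FH; exact/(sub _ FH)/HL.
  have [H [FH Hu _]] := common _ _ Nu Nu.
  by have [_ Hp] := domH _ FH; exact: Hp.
have total z : exists a, (G `|` M) (z, a).
  have [|N [domN MN [a Na]]] := dominated_graph_extend z _ domM.
    by exists g; left.
  exists a; apply: contrapT => nMa; apply: (Mmax N).
    split; first by move=> u Mu; apply: MN; right.
    by move=> NM; apply: nMa; right; exact: NM.
  by rewrite /P /= setUidr// => u Gu; apply: MN; left.
have [f fM] := choice total.
have [ML Mp] := domM.
have fL : linear (f : V -> R^o).
  move=> r x y; apply: (dominated_graph_fun domM (fM _)).
  exact: (ML r _ _ (fM x) (fM y)).
pose fl := GRing.isLinear.Build R V R^o *:%R f fL.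
pose phi : {linear V -> R^o} := HB.pack f fl.
exists phi; split=> [[x a] Gx /=|x]; last exact: (Mp _ (fM x)).
by apply: (dominated_graph_fun domM (fM _)); left.
Qed.

End HahnBanach.

(** * Real-valued norms and norming functionals *)

(** An alias, because a module over [K] must not carry a second canonical
    scaling by [R] when [K] is [R]. *)
Definition restrict_scalars (R : pzRingType) (K : pzRingType)
  (c : {rmorphism R -> K}) (E : lmodType K) : Type := E.

Section RestrictScalars.
Context (R K : pzRingType) (c : {rmorphism R -> K}) (E : lmodType K).
Local Notation V := (restrict_scalars c E).

HB.instance Definition _ := GRing.Zmodule.on V.

Let scale (r : R) (x : V) : V := (c r *: (x : E))%R.

Lemma restrict_scaleA r s x : scale r (scale s x) = scale (r * s) x.
Proof. by rewrite /scale scalerA rmorphM. Qed.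
Lemma restrict_scale1 : left_id 1 scale.
Proof. by move=> x; rewrite /scale rmorph1 scale1r. Qed.
Lemma restrict_scaleDr : right_distributive scale +%R.
Proof. by move=> r x y; exact: scalerDr. Qed.
Lemma restrict_scaleDl x : {morph scale^~ x : r s / r + s}.
Proof. by move=> r s; rewrite /scale rmorphD scalerDl. Qed.

HB.instance Definition _ := GRing.Zmodule_isLmodule.Build R V
  restrict_scaleA restrict_scale1 restrict_scaleDr restrict_scaleDl.
End RestrictScalars.

(** The norm read in R, as in [rnorm] but before the injection in the extended
    reals. *)
Definition rn (R : realType) (K : numFieldType) (re : K -> R)
  (E : normedZmodType K) (x : E) : R := re `|x|.

Section RealNorm.
Context {R : realType} {K : numFieldType} {re : K -> R} {c : {rmorphism R -> K}}.
Hypothesis hs : real_scalars re c.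

Let ge0_c (r : R) : 0 <= r -> 0 <= c r.
Proof. by move=> r0; rewrite -(ger0_norm r0) -(norm_c hs). Qed.

Lemma ler_c (r s : R) : (c r <= c s) = (r <= s).
Proof.
rewrite -subr_ge0 -rmorphB -[RHS]subr_ge0; have [|r0] := leP 0 (s - r).
  exact: ge0_c.
apply/negbTE/negP => cr0; have : c (s - r) == 0.
  by rewrite eq_le cr0 -oppr_ge0 -rmorphN ge0_c// oppr_ge0 ltW.
by rewrite fmorph_eq0 lt_eqF.
Qed.

Lemma ltr_c (r s : R) : (c r < c s) = (r < s).
Proof. by rewrite !lt_neqAle ler_c (inj_eq (fmorph_inj c)). Qed.

Lemma re_c (r : R) : re (c r) = r.
Proof. by rewrite -[c r]mulr1 (reM hs) (re1 hs) mulr1. Qed.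

Lemma re_sum (I : Type) (s : seq I) (F : I -> K) :
  re (\sum_(i <- s) F i) = \sum_(i <- s) re (F i).
Proof.
apply: (big_morph re (reD hs)).
by rewrite -[X in re X](rmorph0 c) re_c.
Qed.

Section Zmod.
Context {E : normedZmodType K}.
Implicit Types x y : E.

Lemma c_rn x : c (rn re x) = `|x|.
Proof. by rewrite /rn -(normr_id x) (re_normK hs). Qed.

Lemma rn_ge0 x : 0 <= rn re x.
Proof. by rewrite -ler_c rmorph0 c_rn. Qed.

Lemma rnD x y : rn re (x + y) <= rn re x + rn re y.
Proof. by rewrite -ler_c rmorphD/= !c_rn ler_normD. Qed.

Lemma rn0 : rn re (0 : E) = 0.
Proof. by rewrite /rn normr0 -(rmorph0 c) re_c. Qed.

Lemma rn_eq0 x : (rn re x == 0) = (x == 0).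
Proof. by rewrite -(inj_eq (fmorph_inj c)) rmorph0 c_rn normr_eq0. Qed.

Lemma rnN x : rn re (- x) = rn re x.
Proof. by rewrite /rn normrN. Qed.

Lemma rn_sum (I : Type) (s : seq I) (F : I -> E) :
  rn re (\sum_(i <- s) F i) <= \sum_(i <- s) rn re (F i).
Proof.
elim/big_ind2 : _ => [|x a y b hx hy|//]; first by rewrite rn0.
by rewrite (le_trans (rnD _ _))// lerD.
Qed.
End Zmod.

Lemma rn1 : rn re (1 : K) = 1.
Proof. by rewrite /rn normr1 (re1 hs). Qed.

Lemma rnM (a b : K) : rn re (a * b) = rn re a * rn re b.
Proof. by apply: (fmorph_inj c); rewrite rmorphM/= !c_rn normrM. Qed.

Lemma rn_c (r : R) : rn re (c r) = `|r|.
Proof. by rewrite /rn (norm_c hs) re_c. Qed.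

Lemma rnZ (E : normedModType K) (a : K) (x : E) :
  rn re (a *: x) = rn re a * rn re x.
Proof. by apply: (fmorph_inj c); rewrite rmorphM/= !c_rn normrZ. Qed.

Lemma rnZc (E : normedModType K) r (x : E) :
  rn re (c r *: x) = `|r| * rn re x.
Proof. by rewrite rnZ rn_c. Qed.

Lemma unimodular (z : K) : exists2 u : K, rn re u = 1 & u * z = c (rn re z).
Proof.
have [->|z0] := eqVneq z 0; first by exists 1; rewrite ?rn1// mulr0 rn0 rmorph0.
exists (`|z| / z); last by rewrite mulfVK// c_rn.
by apply: (fmorph_inj c); rewrite c_rn rmorph1 normf_div normr_id divff ?normr_eq0.
Qed.

Section Dual.
Context {E : normedModType K}.
Implicit Types (x v : E) (phi : {linear E -> K^o}).

Lemma in_dual_bounded phi :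
  in_dual phi <-> exists C, forall x, rn re (phi x) <= C * rn re x.
Proof.
split=> [/(_ 0)/continuous_linear_bounded/linear_boundedP|[C h]].
  move=> /pinfty_ex_gt0[r r0 h]; exists (rn re r) => x.
  by rewrite -ler_c rmorphM/= !c_rn (gtr0_norm r0).
apply: bounded_linear_continuous; apply/linear_boundedP.
exists (c C); split.
  by rewrite realE -!(rmorph0 c) !ler_c -realE num_real.
move=> r Cr x; rewrite (@le_trans _ _ (c C * `|x|))//.
  by rewrite -(c_rn x) -(c_rn (phi x)) -rmorphM/= ler_c.
by rewrite ler_wpM2r// ltW.
Qed.

Lemma dual_norm_le1 phi :
  (dual_norm re phi <= 1)%E <-> forall x, rn re (phi x) <= rn re x.
Proof.
split=> [h x|h]; last first.
  apply: ge_ereal_sup => _ [x x1 <-]; rewrite (le_trans _ x1)// lee_fin; exact: h.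
have [->|x0] := eqVneq x 0; first by rewrite linear0 !rn0.
have rx0 : 0 < rn re x by rewrite lt_neqAle eq_sym rn_eq0 x0 rn_ge0.
pose t := (rn re x)^-1.
have t0 : 0 <= t by rewrite invr_ge0 ltW.
have : (rnorm re (phi (c t *: x)) <= 1)%E.
  apply: le_trans h; apply: ereal_sup_ubound; exists (c t *: x) => //=.
  by rewrite lee_fin -/(rn re _) rnZc ger0_norm// mulVf ?lexx ?gt_eqF.
rewrite lee_fin -/(rn re _) linearZ rnZc ger0_norm//.
by rewrite ler_pdivrMl// mulr1.
Qed.

(** Multiplying [x] by the unimodular scalar that turns phi(x) into its modulus
    makes the bound on the real part a bound on phi itself. *)
Lemma complexify_contraction (f : E -> R) :
  (forall x y, f (x + y) = f x + f y) -> (forall r x, f (c r *: x) = r * f x) ->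
  forall C, (forall x, f x <= C * rn re x) ->
  exists2 phi : {linear E -> K^o}, (forall x, re (phi x) = f x) &
    forall x, rn re (phi x) <= C * rn re x.
Proof.
move=> fD fZ C fC; have [phi hphi] := complexify hs fD fZ.
exists phi => // x; have [u u1 hu] := unimodular (phi x).
rewrite -[leLHS]re_c -hu.
have -> : u * phi x = phi (u *: x) by rewrite linearZ.
by rewrite hphi (le_trans (fC _))// rnZ u1 mul1r.
Qed.

(** Hahn-Banach applied to the multiples of [v], over R. *)
Lemma real_norming v : exists f : E -> R,
  [/\ forall x y, f (x + y) = f x + f y, forall r x, f (c r *: x) = r * f x,
      forall x, f x <= rn re x & f v = rn re v].
Proof.
pose V : lmodType R := restrict_scalars c E.
pose p (x : V) : R := rn re (x : E).
have pD (x y : V) : p (x + y) <= p x + p y by exact: rnD.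
have pZ (r : R) (x : V) : 0 <= r -> p (r *: x) = r * p x.
  by move=> r0; rewrite /p rnZc ger0_norm.
pose G : set (V * R) := [set w | exists r, w = (r *: (v : V), r * rn re v)].
have [||f [fG fp]] := @hahn_banach R V p pD pZ G.
- by exists (0 *: (v : V), 0 * rn re v); exists 0.
- split=> [r _ _ [s ->] [t ->]|_ [r ->]] /=.
    exists (r * s + t); congr (_, _) => /=; last by ring.
    by rewrite scalerDl scalerA.
  by rewrite /p rnZc ler_wpM2r ?rn_ge0// ler_norm.
exists f; split.
- by move=> x y; exact: (linearD f).
- by move=> r x; rewrite -[c r *: x]/(r *: (x : V)) linearZ.
- by [].
- by have := fG (v : V, rn re v); apply; exists 1; rewrite scale1r mul1r.
Qed.

Lemma norming_functional v : exists phi : {linear E -> K^o},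
  [/\ in_dual phi, (dual_norm re phi <= 1)%E & re (phi v) = rn re v].
Proof.
have [f [fD fZ f1 fv]] := real_norming v.
have [|phi hphi phi1] := complexify_contraction fD fZ (C := 1).
  by move=> x; rewrite mul1r.
exists phi; split; [|apply/dual_norm_le1 => x|by rewrite hphi].
- by apply/in_dual_bounded; exists 1.
- by rewrite -[leRHS]mul1r.
Qed.

End Dual.
End RealNorm.

(** * The uniform boundedness principle *)

Section UniformBoundedness.
Context {R : realType} {K : numFieldType} {re : K -> R} {c : {rmorphism R -> K}}.
Hypothesis hs : real_scalars re c.

Lemma norm_re_le_rn (z : K) : `|re z| <= rn re z.
Proof.
rewrite ler_norml (re_le_norm hs) andbT lerNl -rnN.
have -> : - re z = re (- z) by rewrite -[- z]mulN1r -(rmorphN1 c) (reM hs) mulN1r.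
exact: re_le_norm hs _.
Qed.

(** Otherwise pick [v k] in [S] with norm above 4^k k and a norming functional
    [f k] of it, and let [g] accumulate the terms +- 4^-k f k, the sign being
    that of the value already reached at [v k].  Then |g k.+1 (v k)| is at least
    4^-k times the norm of [v k], and all later terms together contribute at most
    a third of that, so the limit [L] is at least (2/3) k in modulus at [v k].
    All this is real-linear; [L] becomes scalar-linear only at the end. *)
Lemma weakly_bounded (E : normedModType K) (S : set E) :
  (forall phi : {linear E -> K^o}, in_dual phi ->
     exists M, forall v, S v -> rn re (phi v) <= M) ->
  exists M, forall v, S v -> rn re v <= M.
Proof.
move=> Sphi; apply: contrapT => /forallNP unbounded.
have /choice[v hv] (k : nat) : exists v, S v /\ 4 ^+ k * k%:R < rn re v.
  have := unbounded (4 ^+ k * k%:R) => /existsNP[v /not_implyP[Sv /negP]].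
  by rewrite -ltNge => ?; exists v.
have /choice[f hf] k := real_norming hs (v k).
have fD k x y : f k (x + y) = f k x + f k y by case: (hf k).
have fZ k r x : f k (c r *: x) = r * f k x by case: (hf k).
have fv k : f k (v k) = rn re (v k) by case: (hf k).
have f_le k x : `|f k x| <= rn re x.
  have [_ _ f1 _] := hf k; rewrite ler_norml f1 andbT lerNl -rnN.
  by rewrite -mulN1r -fZ rmorphN1 scaleN1r.
pose b : R := 4^-1.
have b0 k : 0 <= b ^+ k by rewrite exprn_ge0// invr_ge0.
pose s (t : R) : R := if 0 <= t then 1 else -1.
pose g := fix g k x : R :=
  if k is j.+1 then g j x + s (g j (v j)) * (b ^+ j * f j x) else 0.
have gS k x : g k.+1 x = g k x + s (g k (v k)) * (b ^+ k * f k x) by [].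
have gD k x y : g k (x + y) = g k x + g k y.
  by elim: k => [|k ih]; rewrite ?gS ?ih ?fD /= ?addr0//; ring.
have gZ k r x : g k (c r *: x) = r * g k x.
  by elim: k => [|k ih]; rewrite ?gS ?ih ?fZ /= ?mulr0//; ring.
have s1 t : `|s t| = 1 by rewrite /s; case: ifP; rewrite ?normrN normr1.
have step k x : `|g k.+1 x - g k x| <= b ^+ k * rn re x.
  by rewrite gS addrAC subrr add0r !normrM s1 mul1r ger0_norm// ler_wpM2l.
have tail k m x :
    `|g (k + m)%N x - g k x| <= 4 / 3 * b ^+ k * rn re x * (1 - b ^+ m).
  elim: m => [|m ih]; first by rewrite addn0 subrr normr0 expr0 subrr mulr0.
  rewrite addnS -(subrK (g (k + m)%N x) (g (k + m).+1 x)) -addrA.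
  rewrite (le_trans (ler_normD _ _))// (le_trans (lerD (step _ _) ih))//.
  rewrite exprD exprS le_eqVlt; apply/orP; left; apply/eqP.
  by move: (b ^+ k) (b ^+ m) => B C; rewrite /b; field.
have tail_le k m x : `|g (k + m)%N x - g k x| <= 4 / 3 * b ^+ k * rn re x.
  rewrite (le_trans (tail _ _ _))// ler_piMr ?lerBlDr ?lerDl//.
  by rewrite !mulr_ge0// (rn_ge0 hs).
have big k : b ^+ k * rn re (v k) <= `|g k.+1 (v k)|.
  have p0 : 0 <= b ^+ k * rn re (v k) by rewrite mulr_ge0// (rn_ge0 hs).
  rewrite gS fv /s; have [g0|g0] := leP 0 (g k (v k)).
    by rewrite mul1r ger0_norm ?addr_ge0// lerDr.
  rewrite mulN1r ler0_norm ?opprB ?lerDl ?oppr_ge0 ?(ltW g0)//.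
  by rewrite subr_le0 (le_trans (ltW g0)).
have gcvg x : cvgn (g ^~ x).
  pose u i : R^o := g i.+1 x - g i x.
  have -> : g ^~ x = series u.
    by apply/funext => k; rewrite /series /= /u telescope_sumr// subr0.
  apply: (@normed_cvg R R^o); apply: (@series_le_cvg _ _ (geometric (rn re x) b)).
  - by move=> k; exact: normr_ge0.
  - by move=> k /=; rewrite mulr_ge0// (rn_ge0 hs).
  - by move=> k /=; rewrite mulrC; exact: step.
  - by apply: is_cvg_geometric_series; rewrite ger0_norm /b; lra.
pose L x := limn (g ^~ x).
have LD x y : L (x + y) = L x + L y.
  apply: cvg_lim => //; have -> : g ^~ (x + y) = g ^~ x \+ g ^~ y.
    by apply/funext => k; exact: gD.
  exact: cvgD (gcvg x) (gcvg y).
have LZ r x : L (c r *: x) = r * L x.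
  apply: cvg_lim => //; have -> : g ^~ (c r *: x) = cst r \* g ^~ x.
    by apply/funext => k; exact: gZ.
  exact: cvgM (cvg_cst r) (gcvg x).
have L_near k x : `|L x - g k x| <= 4 / 3 * b ^+ k * rn re x.
  have cv : (fun m => g (m + k)%N x - g k x) @ \oo --> L x - g k x.
    by apply: cvgB; [rewrite (cvg_shiftn k (g ^~ x)); exact: gcvg | exact: cvg_cst].
  rewrite -(cvg_lim _ (cvg_norm cv))//; apply: limr_le.
    by apply/cvg_ex; eexists; exact: cvg_norm cv.
  by apply: nearW => m; rewrite addnC.
have [|phi hphi phi_le] := complexify_contraction hs LD LZ (C := 4 / 3).
  by move=> x; have := L_near 0 x; rewrite subr0 expr0 mulr1;
    apply: le_trans; exact: ler_norm.
have [|M hM] := Sphi phi; first by apply/(in_dual_bounded hs); exists (4 / 3).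
have bound (k : nat) : 2 / 3 * k%:R <= M.
  have [Sv lv] := hv k.
  apply: le_trans (hM _ Sv); apply: le_trans (norm_re_le_rn _); rewrite hphi.
  have h1 := big k; have h2 := L_near k.+1 (v k).
  have h3 : `|g k.+1 (v k)| <= `|L (v k)| + `|L (v k) - g k.+1 (v k)|.
    by rewrite -{1}(subKr (L (v k)) (g k.+1 (v k))) ler_normB.
  have h4 : k%:R <= b ^+ k * rn re (v k).
    by rewrite /b exprVn ler_pdivlMl ?exprn_gt0// ltW.
  move: h2; rewrite exprS [4 / 3 * _]mulrA -[_ * b ^+ k * _]mulrA.
  by rewrite {1}/b; lra.
have M3 : 0 <= 3 * `|M| by rewrite mulr_ge0.
by have := archi_boundP M3; have := bound (Num.bound (3 * `|M|));
  have := ler_norm M; have := normr_ge0 M; lra.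
Qed.
End UniformBoundedness.

(** * Multilinear maps and polarization *)

Section Multilinear.
Context {K : numFieldType} {n : nat} {E : 'I_n -> lmodType K} {F : lmodType K}.
Context {A : (forall m, E m) -> F}.
Hypothesis mA : multilinear A.
Implicit Types x y z : forall m, E m.

Lemma multilinearD x m u v :
  A (dfwith x m (u + v)) = A (dfwith x m u) + A (dfwith x m v).
Proof. by rewrite -[u in LHS]scale1r mA scale1r. Qed.

Lemma multilinear0 x m : x m = 0 -> A x = 0.
Proof.
move=> xm0; have xE : x = dfwith x m 0.
  by apply: functional_extensionality_dep => i; case: dfwithP.
have := multilinearD x 0 0 (m := m); rewrite addr0 -xE => /eqP.
by rewrite -subr_eq0 opprD addrA subrr sub0r oppr_eq0 => /eqP.
Qed.

Lemma multilinearZ x m a u :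
  A (dfwith x m (a *: u)) = a *: A (dfwith x m u).
Proof.
rewrite -[a *: u]addr0 mA [X in _ + X](@multilinear0 _ m) ?addr0//.
exact: dfwithin.
Qed.

Lemma multilinear_scale x (a : 'I_n -> K) :
  A (fun m => a m *: x m) = (\prod_m a m) *: A x.
Proof.
have partial (s : seq 'I_n) : uniq s ->
    A (fun m => if m \in s then a m *: x m else x m) =
    (\prod_(m <- s) a m) *: A x.
  elim: s => [_|i s ih /= /andP[is_ us]]; first by rewrite big_nil scale1r.
  pose w m := if m \in s then a m *: x m else x m.
  have -> : (fun m => if m \in i :: s then a m *: x m else x m) =
            dfwith w i (a i *: x i).
    apply: functional_extensionality_dep => m; case: dfwithP => [|j ij].
      by rewrite inE eqxx.
    by rewrite inE eq_sym (negbTE ij).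
  rewrite multilinearZ big_cons -scalerA -ih//; congr (_ *: A _).
  apply: functional_extensionality_dep => m; case: dfwithP => // .
  by rewrite (negbTE is_).
have := partial (enum 'I_n) (enum_uniq _); rewrite big_enum /= => <-.
by congr A; apply: functional_extensionality_dep => m; rewrite mem_enum.
Qed.

End Multilinear.

Section Polarization.
Context {K : numFieldType} {n : nat} {E : 'I_n -> lmodType K}.
Context {F : normedModType K} {B : (forall m, E m) -> F}.
Hypotheses (n0 : (0 < n)%N) (mB : multilinear B).
Implicit Types (x y z : forall m, E m) (e : 'I_n -> bool) (M : K) (d : F).

Let sg (b : bool) : K := (-1) ^+ b.

Let sgN b : sg (~~ b) = - sg b.
Proof. by case: b; rewrite /sg expr0 expr1 ?opprK. Qed.

Let mix y z k (u : forall m, E m) e : forall m, E m :=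
  fun m => if (m < k)%N then u m else y m + sg (e m) *: z m.

(** Averaging over all sign vectors [e] with product 1 leaves only B y and B z
    in the expansion.  The average is taken one coordinate at a time: for every
    k > 0 the bound holds for B (y_<k, w) + b B (z_<k, w) + d, where b is any sign and
    the coordinates of w from k on are still of the form y + e z.  Passing to
    k + 1 with sign b averages the instance with signs b and e k = 1 and the one
    with signs - b and e k = - 1, which cancels the two mixed terms.  Starting at k = 1 requires a first
    coordinate, hence [n0]. *)
Lemma polarization_step M d y z :
  (forall e, `|B (fun m => y m + (-1) ^+ e m *: z m) + d| <= M) ->
  `|B y + B z + d| <= M.
Proof.
move=> hM.
have mixS k u e (kn : (k < n)%N) (i := Ordinal kn) (e' : 'I_n -> bool) :
    (forall m : 'I_n, (k < m)%N -> e' m = e m) ->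
    mix y z k u e = dfwith (mix y z k.+1 u e') i (y i + sg (e i) *: z i).
  move=> ee; apply: functional_extensionality_dep => m; case: dfwithP => [|j ij].
    by rewrite /mix /= ltnn.
  have jk : (j != k :> nat) by apply: contra ij => /eqP jk; exact/eqP/val_inj.
  rewrite /mix ltnS [(j <= k)%N]leq_eqVlt (negbTE jk) /=; case: ltnP => // kj.
  by rewrite ee// ltn_neqAle eq_sym jk.
have dfwith_id k u e (kn : (k < n)%N) (i := Ordinal kn) :
    dfwith (mix y z k.+1 u e) i (u i) = mix y z k.+1 u e.
  apply: functional_extensionality_dep => m; case: dfwithP => //.
  by rewrite /mix /= ltnSn.
have main k : (0 < k <= n)%N -> forall b e,
    `|B (mix y z k y e) + sg b *: B (mix y z k z e) + d| <= M.
  elim: k => // k ih /= kn b e; pose i := Ordinal kn.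
  pose set_i b' (m : 'I_n) := if m == i then b' else e m.
  have set_iE b' : forall m : 'I_n, (k < m)%N -> e m = set_i b' m.
    by move=> m km; rewrite /set_i; case: eqP km => // ->; rewrite ltnn.
  have set_ii b' : set_i b' i = b' by rewrite /set_i eqxx.
  have split b' u : B (mix y z k u (set_i b')) =
      B (dfwith (mix y z k.+1 u e) i (y i)) +
      sg b' *: B (dfwith (mix y z k.+1 u e) i (z i)).
    by rewrite (mixS _ _ _ kn e (set_iE b')) multilinearD// multilinearZ// set_ii.
  have [k0|k0] := posnP k.
    have := hM (set_i b); suff -> : (fun m => y m + (-1) ^+ set_i b m *: z m) =
        mix y z k y (set_i b).
      rewrite split dfwith_id; congr (`|_ + _ *: B _ + _| <= _).
      apply: functional_extensionality_dep => m.
      case: dfwithP => [|j ij]; first by rewrite /mix /= ltnSn.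
      rewrite /mix ltnS k0 leqn0; case: eqP => // j0.
      by case/eqP: ij; apply: val_inj; rewrite /= k0 j0.
    by apply: functional_extensionality_dep => m; rewrite /mix k0.
  have half : forall b', `|B (mix y z k y (set_i b')) +
      sg (b (+) b') *: B (mix y z k z (set_i b')) + d| <= M.
    by move=> b'; apply: ih; rewrite k0 ltnW.
  have := lerD (half false) (half true); rewrite !split !dfwith_id.
  rewrite addbF addbT sgN /sg expr0 expr1 -/(sg b) !scale1r !scaleN1r.
  move=> h; rewrite -(@ler_pM2l _ 2)// [2 * M]mulr_natl mulr2n.
  have := normrZ (2 : K) (B (mix y z k.+1 y e) + sg b *: B (mix y z k.+1 z e) + d).
  rewrite ger0_norm// => <-.
  apply: le_trans (le_trans (ler_normD _ _) h).
  rewrite le_eqVlt; apply/orP; left; apply/eqP; congr `|_|.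
  rewrite scaler_nat mulr2n scaleNr -scalerN opprB !scalerDr.
  rewrite [_ *: B (dfwith _ _ _) + _]addrC.
  rewrite [LHS]addrACA [X in X + _ = _]addrACA [RHS]addrACA [X in _ = X + _]addrACA.
  rewrite [X in _ = X + _ + _]addrACA [X in _ = _ + X + _]addrACA.
  by rewrite subrr addr0 scalerN subrr addr0.
have := main n; rewrite n0 leqnn => /(_ isT false (fun=> false)).
rewrite scale1r; suff mix_n u : mix y z n u (fun=> false) = u by rewrite !mix_n.
by apply: functional_extensionality_dep => m; rewrite /mix ltn_ord.
Qed.

(** The summands are absorbed one after the other; the point [y] is there to
    carry those already absorbed. *)
Lemma polarization M N (x : nat -> forall m, E m) y :
  (forall e : nat -> 'I_n -> bool,
    `|B (fun m => y m + \sum_(j < N) (-1) ^+ e j m *: x j m)| <= M) ->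
  `|B y + \sum_(j < N) B (x j)| <= M.
Proof.
elim: N y => [|N ih] y hM.
  rewrite big_ord0 addr0; have := hM (fun _ _ => false); congr (`|B _| <= _).
  by apply: functional_extensionality_dep => m; rewrite big_ord0 addr0.
rewrite big_ord_recr /= [_ + B (x N)]addrC addrA; apply: polarization_step => d.
apply: ih => e; have := hM (fun j m => if j == N then d m else e j m).
congr (`|B _| <= _); apply: functional_extensionality_dep => m.
rewrite big_ord_recr /= eqxx addrA -addrA [X in _ + X]addrC addrA.
congr (_ + _ + _); apply: eq_bigr => j _.
by rewrite (ltn_eqF (ltn_ord j)).
Qed.

End Polarization.

(** * Boundedness of continuous multilinear maps *)

Section ProductAtZero.
Context {K : numFieldType} {n : nat} {E : 'I_n -> normedModType K}.

(** The filter generated by the boxes around 0 converges to 0, because it does so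
    coordinatewise. *)
Lemma prod_nbhs0 (U : set (prod_topology E)) :
  nbhs ((fun m => 0 : E m) : prod_topology E) U ->
  exists2 r : K, 0 < r & forall x : forall m, E m, (forall m, `|x m| < r) -> U x.
Proof.
pose ballr (r : K) : set (prod_topology E) := [set x | forall m, `|x m| < r].
pose G : set_system (prod_topology E) := filter_from [set r : K | 0 < r] ballr.
have GF : Filter G.
  apply: filter_from_filter; first by exists 1; exact: ltr01.
  move=> r s /= r0 s0; have [rs|sr] := real_leP (gtr0_real r0) (gtr0_real s0).
    by exists r => // x xr; split=> m //; rewrite (lt_le_trans (xr m)).
  by exists s => // x xs; split=> m //; rewrite (lt_trans (xs m)).
suff G0 : G --> ((fun m => 0 : E m) : prod_topology E) by move=> /G0[r r0 h]; exists r.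
apply/cvg_sup => i B; rewrite nbhsE => -[V [[C oC <-] C0] VB].
have : nbhs (0 : E i) C by apply: open_nbhs_nbhs.
move=> /nbhs_norm0P[r r0 rC]; exists r => // x xr; apply: VB; apply: rC => /=.
exact: xr.
Qed.
End ProductAtZero.

Section Bounded.
Context {R : realType} {K : numFieldType} {re : K -> R} {c : {rmorphism R -> K}}.
Hypothesis hs : real_scalars re c.
Context {n : nat} {E : 'I_n -> normedModType K} {F : normedModType K}.
Context {A : (forall m, E m) -> F}.

Lemma multilinear_le_prod C : multilinear A ->
  (forall x, (forall m, rn re (x m) <= 1) -> rn re (A x) <= C) ->
  forall x, rn re (A x) <= C * \prod_m rn re (x m).
Proof.
move=> mA AC x; have C0 : 0 <= C.
  by rewrite (le_trans (rn_ge0 hs _) (AC (fun=> 0) _))// => m; rewrite (rn0 hs).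
have prod0 : 0 <= \prod_m rn re (x m) by rewrite prodr_ge0// => m _; exact: (rn_ge0 hs).
have [[m xm0]|x0] := pselect (exists m, x m = 0).
  by rewrite (multilinear0 mA xm0) (rn0 hs) mulr_ge0.
have {}x0 m : 0 < rn re (x m).
  rewrite lt_neqAle (rn_ge0 hs) andbT eq_sym (rn_eq0 hs).
  by apply/eqP => xm; apply: x0; exists m.
have := AC (fun m => c (rn re (x m))^-1 *: x m).
rewrite multilinear_scale// -rmorph_prod (rnZc hs) prodfV.
rewrite ger0_norm ?invr_ge0// ler_pdivrMl ?prodr_gt0// mulrC; apply=> m.
by rewrite (rnZc hs) ger0_norm ?invr_ge0 ?(rn_ge0 hs)// mulVf ?gt_eqF.
Qed.

Lemma cont_multilinear_bounded : cont_multilinear A ->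
  exists2 C : R, 0 <= C & forall x, (forall m, rn re (x m) <= 1) -> rn re (A x) <= C.
Proof.
move=> [mA cA]; have [n0|n_gt0] := posnP n.
  exists (rn re (A (fun=> 0))); first exact: (rn_ge0 hs).
  move=> x _; suff -> : x = fun=> 0 by [].
  apply: functional_extensionality_dep => m.
  by have := ltn_ord m; rewrite {2}n0 ltn0.
pose i0 := Ordinal n_gt0.
have A0 : A (fun=> 0) = 0 by exact: (multilinear0 mA (m := i0)).
have : nbhs (A (fun=> 0)) [set y | `|y| < 1].
  by rewrite A0; apply/nbhs_norm0P; exists 1 => /=.
move=> /(cA _)/prod_nbhs0[r r0 hr].
pose s := rn re r / 2.
have rr : c (rn re r) = r by rewrite (c_rn hs) gtr0_norm.
have s0 : 0 < s by rewrite divr_gt0// -(ltr_c hs) rr rmorph0.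
exists (s ^- n); first by rewrite invr_ge0 (exprn_ge0 _ (ltW s0)).
move=> x x1; have : rn re (A (fun m => c s *: x m)) <= 1.
  rewrite -(ler_c hs) (c_rn hs) rmorph1 ltW//; apply: hr => m.
  rewrite -(c_rn hs) -[ltRHS]rr (ltr_c hs) (rnZc hs) gtr0_norm//.
  rewrite (le_lt_trans (ler_piMr (ltW s0) (x1 m)))// /s ltr_pdivrMr// ltr_pMr ?ltr1n//.
  by rewrite -(ltr_c hs) rr rmorph0.
rewrite multilinear_scale// prodr_const card_ord -rmorphXn (rnZc hs).
by rewrite ger0_norm ?(exprn_ge0 _ (ltW s0))// -[_ ^- n]mulr1 ler_pdivlMl ?exprn_gt0.
Qed.

Lemma multilinear_norm_fin : cont_multilinear A ->
  exists2 M : R, 0 <= M & multilinear_norm re A = M%:E /\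
    forall x, rn re (A x) <= M * \prod_m rn re (x m).
Proof.
move=> cmA; have [C C0 AC] := cont_multilinear_bounded cmA.
pose S := [set rnorm re (A x) |
    x in [set x : forall m, E m | forall m, (rnorm re (x m) <= 1)%E]].
have S0 : S (rnorm re (A (fun=> 0))).
  by exists (fun=> 0) => //= m; rewrite lee_fin -/(rn re _) (rn0 hs).
have leC : (multilinear_norm re A <= C%:E)%E.
  apply: ge_ereal_sup => _ [x x1 <-]; rewrite lee_fin; apply: AC => m.
  by have := x1 m; rewrite lee_fin.
have ge0 : (0 <= multilinear_norm re A)%E.
  by apply: le_trans (ereal_sup_ubound S0); rewrite lee_fin; exact: (rn_ge0 hs).
have fin : multilinear_norm re A \is a fin_num.
  by rewrite fin_numElt (lt_le_trans _ ge0) ?ltNyr//= (le_lt_trans leC) ?ltry.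
exists (fine (multilinear_norm re A)); first exact: fine_ge0.
split; first by rewrite fineK.
apply: multilinear_le_prod; first by case: cmA.
move=> x x1; rewrite -lee_fin fineK//; apply: ereal_sup_ubound.
by exists x => // m; rewrite lee_fin; exact: x1.
Qed.

End Bounded.

(** * Weakly summable sequences and induced operators *)

Section WeaklySummable.
Context {R : realType} {K : numFieldType} {re : K -> R} {c : {rmorphism R -> K}}.
Hypothesis hs : real_scalars re c.

Lemma lp1_normE (a : nat -> K^o) :
  lp_norm re 1 a = (\sum_(0 <= k <oo) (rn re (a k))%:E)%E.
Proof.
rewrite /lp_norm Lnorm1 ge0_integral_count; last by move=> k; exact: abse_ge0.
by apply: eq_eseriesr => k _; rewrite gee0_abs// lee_fin; exact: (rn_ge0 hs).
Qed.

Lemma lp1_norm_le (a : nat -> K^o) (M : R) : (lp_norm re 1 a <= M%:E)%E <->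
  forall N, \sum_(j < N) rn re (a j) <= M.
Proof.
have a0 k : xpredT k -> (0 <= (rn re (a k))%:E)%E.
  by move=> _; rewrite lee_fin; exact: (rn_ge0 hs).
rewrite lp1_normE; split=> [h N|h].
  rewrite -lee_fin -sumEFin -(big_mkord xpredT (fun j => (rn re (a j))%:E)).
  by apply: le_trans h; apply: nneseries_lim_ge => k _; exact: a0.
apply: lime_le; first by apply: is_cvg_nneseries => k _; exact: a0.
by apply: nearW => N; rewrite big_mkord sumEFin lee_fin.
Qed.

Lemma lp_norm_ge0 p (a : nat -> K^o) : (0 <= lp_norm re p a)%E.
Proof. exact: Lnorm_ge0. Qed.

Context {E : normedModType K}.
Implicit Types x : nat -> E.

Lemma weak_norm_ge0 p x : (0 <= weak_norm re p x)%E.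
Proof.
have [phi [phi_dual phi1 _]] := norming_functional hs (0 : E).
by apply: le_trans (lp_norm_ge0 p _) _; apply: ereal_sup_ubound; exists phi.
Qed.

Lemma weak_norm1_le x (M : R) : (weak_norm re 1 x <= M%:E)%E <->
  forall phi : {linear E -> K^o}, in_dual phi -> (dual_norm re phi <= 1)%E ->
  forall N, \sum_(j < N) rn re (phi (x j)) <= M.
Proof.
split=> [h phi phid phi1|h].
  apply/(lp1_norm_le (fun j => phi (x j))); apply: le_trans h; apply: ereal_sup_ubound.
  by exists phi.
apply: ge_ereal_sup => _ [phi [phid phi1] <-]; apply/lp1_norm_le.
exact: h.
Qed.

(** Evaluate a norming functional of the sum. *)
Lemma weak_norm1_sum x (M : R) : (weak_norm re 1 x <= M%:E)%E ->
  forall N (d : nat -> K), (forall j, rn re (d j) = 1) ->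
  rn re (\sum_(j < N) d j *: x j) <= M.
Proof.
move=> /weak_norm1_le h N d d1.
have [phi [phid phi1 <-]] := norming_functional hs (\sum_(j < N) d j *: x j).
apply: le_trans (h _ phid phi1 N); rewrite linear_sum (re_sum hs).
apply: ler_sum => j _; apply: le_trans (re_le_norm hs _) _.
by rewrite -/(rn re _) linearZ (rnZ hs) d1 mul1r.
Qed.

Lemma unimodular_sum N (z : nat -> K) : exists2 d : nat -> K,
  (forall j, rn re (d j) = 1) & \sum_(j < N) d j * z j = c (\sum_(j < N) rn re (z j)).
Proof.
have /choice[d hd] (j : nat) : exists d, rn re d = 1 /\ d * z j = c (rn re (z j)).
  by have [d] := unimodular hs (z j); exists d.
exists d; first by move=> j; case: (hd j).
by rewrite rmorph_sum; apply: eq_bigr => j _; case: (hd j).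
Qed.

(** The finite sums of unimodular multiples of the x_j are weakly bounded,
    a functional phi being at most sum_j |phi (x_j)| on them; so they are
    bounded, and a suitable choice of the multiples makes phi of such a sum equal
    to a partial sum of the |phi (x_j)|. *)
Lemma weakly_summable_norm_fin x : weakly_summable re 1 x ->
  exists2 M : R, 0 <= M & (weak_norm re 1 x <= M%:E)%E.
Proof.
move=> wx; pose S := [set v | exists N (d : nat -> K),
  (forall j, rn re (d j) = 1) /\ v = \sum_(j < N) d j *: x j].
have [M hM] : exists M, forall v, S v -> rn re v <= M.
  apply: (weakly_bounded hs) => phi /wx phix.
  have fin : lp_norm re 1 (fun j => phi (x j)) \is a fin_num.
    by rewrite ge0_fin_numE ?lp_norm_ge0.
  exists (fine (lp_norm re 1 (fun j => phi (x j)))) => _ [N [d [d1 ->]]].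
  have /lp1_norm_le/(_ N) : (lp_norm re 1 (fun j => phi (x j)) <=
    (fine (lp_norm re 1 (fun j => phi (x j))))%:E)%E by rewrite fineK.
  apply: le_trans; rewrite linear_sum (le_trans (rn_sum hs _ _))//.
  by apply: ler_sum => j _; rewrite linearZ (rnZ hs) d1 mul1r.
exists M.
  have /hM : S 0 by exists 0, (fun=> 1); split=> [_|]; rewrite ?(rn1 hs)// big_ord0.
  by rewrite (rn0 hs).
apply/weak_norm1_le => phi phid /(dual_norm_le1 hs) phi1 N.
have [d d1 hd] := unimodular_sum N (fun j => phi (x j)).
have /hM : S (\sum_(j < N) d j *: x j) by exists N, d.
apply: le_trans; apply: le_trans (phi1 _).
have -> : phi (\sum_(j < N) d j *: x j) = c (\sum_(j < N) rn re (phi (x j))).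
  by rewrite linear_sum -hd; apply: eq_bigr => j _; rewrite linearZ.
rewrite (rn_c hs) ger0_norm// sumr_ge0// => j _.
exact: (rn_ge0 hs).
Qed.

End WeaklySummable.

Section Induced.
Context {R : realType} {K : numFieldType} {re : K -> R} {c : {rmorphism R -> K}}.
Hypothesis hs : real_scalars re c.
Context {n : nat} {E : 'I_n -> normedModType K} {F : normedModType K}.
Context {A : (forall m, E m) -> F}.
Hypotheses (n0 : (0 < n)%N) (mA : multilinear A).

(** The diagonal inequality behind stability for p = 1, by polarization of
    phi o A. *)
Lemma induced_sum_le (C D : R) (phi : {linear F -> K^o})
    (x : forall m, nat -> E m) (w : 'I_n -> R) N :
  (forall y, rn re (A y) <= C * \prod_m rn re (y m)) -> 0 <= C ->
  (forall v, rn re (phi v) <= D * rn re v) -> 0 <= D ->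
  (forall m, weak_norm re 1 (x m) <= (w m)%:E)%E ->
  \sum_(j < N) rn re (phi (A (fun m => x m j))) <= D * (C * \prod_m w m).
Proof.
move=> AC C0 phiD D0 xw.
pose B (y : forall m, E m) : K^o := phi (A y).
have mB : multilinear B by move=> y m a u v; rewrite /B mA linearP.
have [d d1 hd] := unimodular_sum hs N (fun j => B (fun m => x m j)).
pose i0 := Ordinal n0.
(* The phases are all put on the first argument, which exists by [n0]. *)
pose d' (j : nat) (m : 'I_n) : K := if m == i0 then d j else 1.
pose x' j m := d' j m *: x m j.
have Bx' j : B (x' j) = d j * B (fun m => x m j).
  rewrite /x' multilinear_scale// (bigD1 i0)//= {1}/d' eqxx big1 ?mulr1// => m mi.
  by rewrite /d' (negbTE mi).
have w0 m : 0 <= w m.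
  by rewrite -lee_fin (le_trans (weak_norm_ge0 hs _ _) (xw m)).
have := @polarization _ _ _ _ B n0 mB (c (D * (C * \prod_m w m))) N x' (fun=> 0).
rewrite (@multilinear0 _ _ _ _ _ mB _ i0 erefl) add0r => polB.
have {polB} := polB; rewrite (eq_bigr _ (fun (j : 'I_N) _ => Bx' j)) hd.
rewrite -(c_rn hs) (ler_c hs) (rn_c hs) ger0_norm; last first.
  by apply: sumr_ge0 => j _; exact: (rn_ge0 hs).
apply=> e; rewrite -(c_rn hs) (ler_c hs) (le_trans (phiD _))//.
rewrite ler_wpM2l// (le_trans (AC _))// ler_wpM2l//.
apply: ler_prod => m _; rewrite (rn_ge0 hs) /= add0r /x'.
under eq_bigr do rewrite scalerA.
apply: (weak_norm1_sum hs (xw m) N (d := fun j => (-1) ^+ e j m * d' j m)) => j.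
rewrite (rnM hs) /d'; case: ifP => _; rewrite ?d1 ?(rn1 hs) mulr1.
  by rewrite /rn normrX normrN1 expr1n (re1 hs).
by rewrite /rn normrX normrN1 expr1n (re1 hs).
Qed.

Lemma induced_weak_norm_le (C : R) (x : forall m, nat -> E m) (w : 'I_n -> R) :
  (forall y, rn re (A y) <= C * \prod_m rn re (y m)) -> 0 <= C ->
  (forall m, weak_norm re 1 (x m) <= (w m)%:E)%E ->
  (weak_norm re 1 (fun j => A (fun m => x m j)) <= (C * \prod_m w m)%:E)%E.
Proof.
move=> AC C0 xw; apply/(weak_norm1_le hs) => phi _ /(dual_norm_le1 hs) phi1 N.
rewrite -[leRHS]mul1r; apply: induced_sum_le => // v.
by rewrite mul1r.
Qed.

Lemma induced_weakly_summable (C : R) (x : forall m, nat -> E m) :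
  (forall y, rn re (A y) <= C * \prod_m rn re (y m)) -> 0 <= C ->
  (forall m, weakly_summable re 1 (x m)) ->
  weakly_summable re 1 (fun j => A (fun m => x m j)).
Proof.
move=> AC C0 wx phi /(in_dual_bounded hs)[D phiD].
have {}phiD v : rn re (phi v) <= `|D| * rn re v.
  by rewrite (le_trans (phiD v))// ler_wpM2r ?(rn_ge0 hs)// ler_norm.
have /choice[w hw] m : exists w : R, (weak_norm re 1 (x m) <= w%:E)%E.
  by have [w] := weakly_summable_norm_fin hs (wx m); exists w.
rewrite /in_lp (@le_lt_trans _ _ (`|D| * (C * \prod_m w m))%:E) ?ltry//.
by apply/(lp1_norm_le hs) => N; exact: induced_sum_le.
Qed.

Lemma induced_tail_cvg0 (C : R) (x : forall m, nat -> E m) :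
  (forall y, rn re (A y) <= C * \prod_m rn re (y m)) -> 0 <= C ->
  (forall m, weak_norm re 1 (fun j => x m (k + j)%N) @[k --> \oo] --> 0%E) ->
  weak_norm re 1 (fun j => A (fun m => x m (k + j)%N)) @[k --> \oo] --> 0%E.
Proof.
move=> AC C0 cx.
have smallx m (e : R) : 0 < e ->
    \forall k \near \oo, (weak_norm re 1 (fun j => x m (k + j)%N) <= e%:E)%E.
  move=> e0; have := cx m => /fine_cvgP[xfin /cvgrPdist_le/(_ _ e0)].
  move: xfin; apply: filterS2 => k kfin; rewrite sub0r normrN => h.
  by rewrite -(fineK kfin) lee_fin (le_trans (ler_norm _)).
have small (e : R) : 0 < e -> \forall k \near \oo,
    (weak_norm re 1 (fun j => A (fun m => x m (k + j)%N)) <= e%:E)%E.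
  (* With t <= 1 and n > 0, the product t ^+ n of the bounds is at most t. *)
  move=> e0; pose t := Num.min 1 (e / (C + 1)).
  have C1 : 0 < C + 1 by rewrite ltr_wpDl.
  have t0 : 0 < t by rewrite lt_min ltr01 divr_gt0.
  have : \forall k \near \oo, forall m,
      (weak_norm re 1 (fun j => x m (k + j)%N) <= t%:E)%E.
    by apply: filter_forall => m; exact: smallx.
  apply: filterS => k xk.
  rewrite (le_trans (induced_weak_norm_le AC C0 xk))// lee_fin prodr_const card_ord.
  have tn : t ^+ n <= t.
    by rewrite -[leRHS]expr1 ler_wiXn2l// ?(ltW t0)// ge_min lexx.
  rewrite (le_trans (ler_wpM2l C0 tn))// (@le_trans _ _ ((C + 1) * t))//.
    by rewrite ler_wpM2r ?(ltW t0)// lerDl.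
  by rewrite mulrC -ler_pdivlMr// ge_min lexx orbT.
apply/fine_cvgP; split.
  have := small 1 ltr01; apply: filterS => k k1.
  by rewrite ge0_fin_numE ?(weak_norm_ge0 hs)// (le_lt_trans k1)// ltry.
apply/cvgrPdist_le => e e0; have := small e e0; apply: filterS => k ke.
rewrite sub0r normrN /= ger0_norm ?fine_ge0 ?(weak_norm_ge0 hs)//.
rewrite -lee_fin fineK// ge0_fin_numE ?(weak_norm_ge0 hs)//.
by rewrite (le_lt_trans ke)// ltry.
Qed.

End Induced.

(** * Stability for p = 1 *)

Section Stable.
Context {R : realType} {K : numFieldType} {re : K -> R} {c : {rmorphism R -> K}}.
Hypothesis hs : real_scalars re c.

Lemma weak_norm_zero p (E : normedModType K) : 0 < p ->
  weak_norm re p (fun _ => 0 : E) = 0%E.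
Proof.
move=> p0; apply/eqP; rewrite eq_le (weak_norm_ge0 hs) andbT.
apply: ge_ereal_sup => _ [phi _ <-]; rewrite /lp_norm.
rewrite (_ : (fun _ => _) = cst 0%E) ?Lnorm0 ?eqe ?gt_eqF//.
by apply/funext => j; rewrite linear0 /rnorm -/(rn re _) (rn0 hs).
Qed.

Lemma lpu_eventually0 p (E : completeNormedModType K) (x : nat -> E) N :
  0 < p -> (forall j, (N <= j)%N -> x j = 0) -> weakly_summable re p x ->
  seq_mem (lpu re p) x.
Proof.
move=> p0 x0 wx; split => //; apply: cvg_near_cst.
near=> k; rewrite -(weak_norm_zero E p0); congr weak_norm.
apply/funext => j; apply: x0; rewrite (leq_trans _ (leq_addr _ _))//.
by near: k; exact: nbhs_infty_ge.
Unshelve. all: by end_near. Qed.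

Definition single (E : zmodType) (v : E) (j : nat) : E := if j == 0%N then v else 0.

Lemma single_weak_norm (E : normedModType K) (v : E) :
  (weak_norm re 1 (single v) <= (rn re v)%:E)%E.
Proof.
apply/(weak_norm1_le hs) => phi _ /(dual_norm_le1 hs) phi1 [|N].
  by rewrite big_ord0 (rn_ge0 hs).
rewrite big_ord_recl /= big1 ?addr0; first exact: phi1.
by move=> j _; rewrite /single /= linear0 (rn0 hs).
Qed.

Lemma single_weakly_summable (E : normedModType K) (v : E) :
  weakly_summable re 1 (single v).
Proof.
move=> phi _; rewrite /in_lp (@le_lt_trans _ _ (rn re (phi v))%:E) ?ltry//.
apply/(lp1_norm_le hs) => -[|N]; first by rewrite big_ord0 (rn_ge0 hs).
rewrite big_ord_recl /= big1 ?addr0 //.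
by move=> j _; rewrite /single /= linear0 (rn0 hs).
Qed.

(** The lower bound is seen on sequences that vanish after their first term:
    their weak norms are the norms of the first terms. *)
Lemma induced_norm_eq (X : seq_rule) n (E : 'I_n -> completeNormedModType K)
    (F : completeNormedModType K) (A : (forall m, E m) -> F) :
  (forall (G : completeNormedModType K) (x : nat -> G),
     seq_norm X x = weak_norm re 1 x) ->
  (forall (G : completeNormedModType K) (v : G), seq_mem X (single v)) ->
  (0 < n)%N -> cont_multilinear A ->
  induced_norm X A = multilinear_norm re A.
Proof.
move=> Xw Xsingle n0 cmA; have [mA _] := cmA.
have [C C0 [AC Aprod]] := multilinear_norm_fin hs cmA.
apply/eqP; rewrite eq_le; apply/andP; split.
  rewrite AC; apply: ge_ereal_sup => _ [x hx <-]; rewrite Xw.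
  have := induced_weak_norm_le hs n0 mA (x := x) (w := fun=> 1) Aprod C0.
  rewrite big1 ?mulr1//; apply=> m.
  by have [_] := hx m; rewrite Xw.
apply: ge_ereal_sup => _ [x x1 <-].
pose xs m := single (x m).
apply: (@le_trans _ _ (seq_norm X (Defs.induced A xs))); last first.
  apply: ereal_sup_ubound; exists xs => // m; split; first exact: Xsingle.
  by rewrite Xw (le_trans (single_weak_norm _))//; exact: x1.
rewrite Xw; have [phi [phid phi1 phiA]] := norming_functional hs (A x).
apply: (@le_trans _ _ (lp_norm re 1 (fun j => phi (Defs.induced A xs j)))); last first.
  by apply: ereal_sup_ubound; exists phi.
rewrite (lp1_normE hs).
have := @nneseries_lim_ge R (fun k => (rn re (phi (Defs.induced A xs k)))%:E) xpredT 0 1.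
rewrite big_nat1 => h; apply: le_trans (h _); last first.
  by move=> k _ _; rewrite lee_fin (rn_ge0 hs).
have -> : Defs.induced A xs 0%N = A x by [].
by rewrite lee_fin -/(rn re _) -phiA; exact: (re_le_norm hs).
Qed.

Theorem lpw1_stable : multilinearly_stable re (lpw re 1).
Proof.
move=> n E F A n0 cmA; have [mA _] := cmA.
have [C C0 [AC Aprod]] := multilinear_norm_fin hs cmA.
split; last first.
  apply: induced_norm_eq => // G v; exact: single_weakly_summable.
by move=> x wx; exact: (induced_weakly_summable hs n0 mA Aprod C0 wx).
Qed.

Theorem lpu1_stable : multilinearly_stable re (lpu re 1).
Proof.
move=> n E F A n0 cmA; have [mA _] := cmA.
have [C C0 [AC Aprod]] := multilinear_norm_fin hs cmA.
split; last first.
  apply: induced_norm_eq => // G v; apply: (@lpu_eventually0 _ _ _ 1) => //.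
    by case.
  exact: single_weakly_summable.
move=> x ux; split.
  by apply: (induced_weakly_summable hs n0 mA Aprod C0) => m; case: (ux m).
by apply: (induced_tail_cvg0 hs n0 mA Aprod C0) => m; case: (ux m).
Qed.

End Stable.

(** * The Euclidean plane *)

Section EuclideanNorm.
Context {R : realType}.
Implicit Types a b : R.

Definition norm2 a b : R := Num.sqrt (a ^+ 2 + b ^+ 2).

Lemma norm2_sqr a b : norm2 a b ^+ 2 = a ^+ 2 + b ^+ 2.
Proof. by rewrite sqr_sqrtr// addr_ge0// sqr_ge0. Qed.

Lemma norm2_ge0 a b : 0 <= norm2 a b.
Proof. exact: sqrtr_ge0. Qed.

Lemma norm2_le a b r : 0 <= r -> (norm2 a b <= r) = (a ^+ 2 + b ^+ 2 <= r ^+ 2).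
Proof. by move=> r0; rewrite -(ler_sqr (norm2_ge0 _ _) r0) norm2_sqr. Qed.

Lemma cauchy_schwarz2 a b a' b' : a * a' + b * b' <= norm2 a b * norm2 a' b'.
Proof.
rewrite (le_trans (ler_norm _))// -ler_sqr ?nnegrE ?mulr_ge0 ?norm2_ge0//.
rewrite real_normK ?num_real// exprMn !norm2_sqr -subr_ge0.
have -> : (a ^+ 2 + b ^+ 2) * (a' ^+ 2 + b' ^+ 2) - (a * a' + b * b') ^+ 2 =
  (a * b' - b * a') ^+ 2 by ring.
exact: sqr_ge0.
Qed.

Lemma norm2D a b a' b' : norm2 (a + a') (b + b') <= norm2 a b + norm2 a' b'.
Proof.
rewrite norm2_le ?addr_ge0 ?norm2_ge0//.
have := cauchy_schwarz2 a b a' b'; have := norm2_sqr a b.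
by have := norm2_sqr a' b'; rewrite !expr2; nra.
Qed.

End EuclideanNorm.

(** The Euclidean plane over the scalars.  An alias of the product, which
    itself is normed by the maximum; the proof of [real_scalars re c] is a
    parameter because the axioms of the norm depend on it. *)
Definition euclid2 (R : realType) (K : numFieldType) (re : K -> R)
  (c : {rmorphism R -> K}) of real_scalars re c : Type := (K^o * K^o)%type.

(** An alias of K that carries its completeness, known only through
    [complete_scalars]. *)
Definition scalar_space (R : realType) (K : numFieldType) (re : K -> R)
  (c : {rmorphism R -> K}) of real_scalars re c : Type := K^o.

Section Spaces.
Context {R : realType} {K : numFieldType} {re : K -> R} {c : {rmorphism R -> K}}.
Variable hs : real_scalars re c.
Local Notation H := (euclid2 hs).

HB.instance Definition _ := GRing.Lmodule.copy H (K^o * K^o)%type.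

Let norm (x : H) : K := c (norm2 (rn re x.1) (rn re x.2)).

Lemma euclid2_normD x y : norm (x + y) <= norm x + norm y.
Proof.
rewrite -rmorphD (ler_c hs) (le_trans _ (norm2D _ _ _ _))//.
rewrite norm2_le ?norm2_ge0// norm2_sqr lerD//;
  by rewrite lerXn2r ?nnegrE ?addr_ge0 ?(rn_ge0 hs)// (rnD hs).
Qed.

Lemma euclid2_normZ (a : K) (x : H) : norm (a *: x) = `|a| * norm x.
Proof.
rewrite /norm /= !(rnM hs) -(c_rn hs a) -rmorphM /=; congr (c _).
by rewrite /norm2 !exprMn -mulrDr sqrtrM ?sqr_ge0// sqrtr_sqr ger0_norm ?(rn_ge0 hs).
Qed.

Lemma euclid2_norm_eq0 (x : H) : norm x = 0 -> x = 0.
Proof.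
move/eqP; rewrite fmorph_eq0 sqrtr_eq0 le_eqVlt ltNge addr_ge0 ?sqr_ge0// orbF.
rewrite paddr_eq0 ?sqr_ge0// !sqrf_eq0 !(rn_eq0 hs) => /andP[/eqP x1 /eqP x2].
by rewrite [x]surjective_pairing x1 x2.
Qed.

HB.instance Definition _ := Lmodule_isNormed.Build K H
  euclid2_normD euclid2_normZ euclid2_norm_eq0.

Lemma rn_euclid2 (x : H) : rn re x = norm2 (rn re x.1) (rn re x.2).
Proof. by apply: (fmorph_inj c); rewrite (c_rn hs). Qed.

Lemma rn_fst_le (x : H) : rn re x.1 <= rn re x.
Proof.
rewrite rn_euclid2 -ler_sqr ?nnegrE ?(rn_ge0 hs) ?norm2_ge0// norm2_sqr.
by rewrite lerDl sqr_ge0.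
Qed.

Lemma rn_snd_le (x : H) : rn re x.2 <= rn re x.
Proof.
rewrite rn_euclid2 -ler_sqr ?nnegrE ?(rn_ge0 hs) ?norm2_ge0// norm2_sqr.
by rewrite lerDr sqr_ge0.
Qed.

Lemma norm_euclid2_le (x : H) : `|x| <= `|x.1| + `|x.2|.
Proof.
rewrite -!(c_rn hs) -rmorphD (ler_c hs) rn_euclid2 norm2_le ?addr_ge0 ?(rn_ge0 hs)//.
by rewrite sqrrD lerD2r lerDl mulrn_wge0// mulr_ge0 ?(rn_ge0 hs).
Qed.

Lemma euclid2_complete (F : set_system H) : ProperFilter F -> cauchy F -> cvg F.
Proof.
move=> FF /cauchy_ballP Fc.
have part (g : H -> K) : (forall x y, g (x - y) = g x - g y) ->
    (forall z, rn re (g z) <= rn re z) -> cvg (g @ F).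
  move=> gB gle; apply: (complete_scalars hs); apply/cauchy_ballP => e e0.
  rewrite near_map2; have := Fc _ e0; apply: filterS => -[x y] /=.
  rewrite -!ball_normE /= => h.
  by rewrite -gB (le_lt_trans _ h)// -!(c_rn hs) (ler_c hs).
have /cvg_ex[a /cvgrPdist_lt ha] := part fst (fun _ _ => erefl) rn_fst_le.
have /cvg_ex[b /cvgrPdist_lt hb] := part snd (fun _ _ => erefl) rn_snd_le.
apply/cvg_ex; exists ((a, b) : H); apply/cvgrPdist_lt => e e0.
have e2 : 0 < e / 2 by rewrite divr_gt0.
near=> z; rewrite (le_lt_trans (norm_euclid2_le _))// (splitr e).
by rewrite ltrD//; near: z; [exact: ha _ e2 | exact: hb _ e2].
Unshelve. all: by end_near. Qed.

HB.instance Definition _ := Uniform_isComplete.Build H euclid2_complete.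

HB.instance Definition _ := NormedModule.copy (scalar_space hs) K^o.
HB.instance Definition _ :=
  Uniform_isComplete.Build (scalar_space hs) (complete_scalars hs).

End Spaces.

(** * Failure of stability for p > 1 *)

(** Expand the square: s^(2p) + t^(2p) <= s^2 + t^2 <= 1 since s, t <= 1 <= p, and
    s t <= 1/2 bounds the mixed term 2 (s t)^p by 2^(1 - p). *)
Lemma sum_powR_sqr_le (R : realType) (p s t : R) :
  1 < p -> 0 <= s -> 0 <= t -> s ^+ 2 + t ^+ 2 <= 1 ->
  (s `^ p + t `^ p) ^+ 2 <= 1 + 2 `^ (1 - p).
Proof.
move=> p1 s0 t0 st1.
have p0 : 0 <= p by rewrite ltW// (lt_trans _ p1).
have sqr_le (u : R) : 0 <= u -> u ^+ 2 <= 1 -> (u `^ p) ^+ 2 <= u ^+ 2.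
  move=> u0 u1; rewrite -[X in (X) ^+ 2]/(u `^ p) expr2 -powRM// -expr2.
  have [->|u2] := eqVneq (u ^+ 2) 0; first by rewrite powR0 ?gt_eqF ?(lt_trans _ p1).
  rewrite -[leRHS]powRr1 ?sqr_ge0// ger_powR ?(ltW p1)// u1 andbT.
  by rewrite lt_neqAle eq_sym u2 sqr_ge0.
have st2 : s * t <= 2^-1 by have := sqr_ge0 (s - t); rewrite !expr2 in st1 *; nra.
have mixed : s `^ p * t `^ p <= 2^-1 `^ p.
  by rewrite -powRM// ge0_ler_powR ?nnegrE ?mulr_ge0.
have -> : 2 `^ (1 - p) = 2 * 2^-1 `^ p :> R.
  by rewrite powRD ?pnatr_eq0 ?implybT// powRr1// -[2^-1]powR_inv1// -powRrM mulN1r.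
have s1 := sqr_le s s0 (le_trans _ st1); have t1 := sqr_le t t0 (le_trans _ st1).
rewrite sqrrD.
have := s1 _; rewrite lerDl sqr_ge0 => /(_ isT).
have := t1 _; rewrite lerDr sqr_ge0 => /(_ isT).
by rewrite -mulr_natl; lra.
Qed.

Section Unstable.
Context {R : realType} {K : numFieldType} {re : K -> R} {c : {rmorphism R -> K}}.
Hypothesis hs : real_scalars re c.
Local Notation H := (euclid2 hs).

Lemma lp_norm_pair (p : R) (a : nat -> K^o) : 0 < p ->
  (forall j, (2 <= j)%N -> a j = 0) ->
  lp_norm re p a = (((rn re (a 0%N)) `^ p + (rn re (a 1%N)) `^ p) `^ p^-1)%:E.
Proof.
move=> p0 a0; rewrite /lp_norm Lnorm_counting//.
rewrite (nneseries_split 0 2); last by move=> k _; exact: poweR_ge0.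
rewrite eseries0 ?adde0; last first.
  by move=> k k2 _; rewrite a0// /rnorm -/(rn re _) (rn0 hs) abse0 poweR0r ?gt_eqF.
rewrite /index_iota /= !big_cons big_nil adde0.
by rewrite -!/(rn re _) !ger0_norm ?(rn_ge0 hs).
Qed.

Lemma euclid2_basis (x : H) : x = x.1 *: ((1, 0) : H) + x.2 *: ((0, 1) : H).
Proof.
rewrite [LHS]surjective_pairing; congr (_, _).
  by rewrite -[RHS]/(x.1 * 1 + x.2 * 0) mulr1 mulr0 addr0.
by rewrite -[RHS]/(x.1 * 0 + x.2 * 1) mulr1 mulr0 add0r.
Qed.

(** The dual of the Euclidean plane is Euclidean: test phi at the vector whose
    coordinates are the conjugates of phi(e_1) and phi(e_2), written here as modulus
    times phase. *)
Lemma dual_norm_euclid2 (phi : {linear H -> K^o}) : (dual_norm re phi <= 1)%E ->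
  (rn re (phi (1, 0))) ^+ 2 + (rn re (phi (0, 1))) ^+ 2 <= 1.
Proof.
move=> /(dual_norm_le1 hs) phi1.
set a := phi _; set b := phi _.
have [u u1 ua] := unimodular hs a; have [v v1 vb] := unimodular hs b.
pose y : H := (c (rn re a) * u, c (rn re b) * v).
have yE : y = y.1 *: ((1, 0) : H) + y.2 *: ((0, 1) : H).
  exact: euclid2_basis.
have := phi1 y; rewrite yE linearD !linearZ -yE -/a -/b /=.
rewrite -[_ *: a]mulrA -[_ *: b]mulrA ua vb -!rmorphM -rmorphD (rn_c hs).
rewrite rn_euclid2 /= !(rnM hs) u1 v1 !mulr1 !(rn_c hs).
rewrite !ger0_norm ?addr_ge0 ?mulr_ge0 ?(rn_ge0 hs)//.
rewrite -!expr2 -norm2_sqr => h.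
have n0 := norm2_ge0 (rn re a) (rn re b).
by rewrite expr2 in h *; nra.
Qed.

Definition dot (x : forall m : 'I_2, H) : scalar_space hs :=
  (x ord0).1 * (x ord_max).1 + (x ord0).2 * (x ord_max).2.

Lemma dot_multilinear : multilinear dot.
Proof.
move=> x m a u v; rewrite /dot.
have [->|->] : m = ord0 \/ m = ord_max.
  by case: m => [[|[|//]] h]; [left|right]; exact: val_inj.
- rewrite !dfwithin !dfwithout//; case: (x ord_max) => y1 y2.
  rewrite -[LHS]/((a * u.1 + v.1) * y1 + (a * u.2 + v.2) * y2 : K).
  by rewrite -[RHS]/(a * (u.1 * y1 + u.2 * y2) + (v.1 * y1 + v.2 * y2) : K); ring.
- rewrite !dfwithin !dfwithout//; case: (x ord0) => y1 y2.
  rewrite -[LHS]/(y1 * (a * u.1 + v.1) + y2 * (a * u.2 + v.2) : K).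
  by rewrite -[RHS]/(a * (y1 * u.1 + y2 * u.2) + (y1 * v.1 + y2 * v.2) : K); ring.
Qed.

Lemma dot_continuous : continuous (dot : prod_topology (fun _ : 'I_2 => H) -> _).
Proof.
have cont (g : H -> K^o) : linear g -> (forall x, rn re (g x) <= rn re x) -> continuous g.
  move=> gL gle; pose gl := GRing.isLinear.Build K H K^o *:%R g gL.
  pose phi : {linear H -> K^o} := HB.pack g gl.
  have : in_dual phi by apply/(in_dual_bounded hs); exists 1 => x;
    rewrite mul1r; exact: gle.
  by [].
have c1 : continuous (fst : H -> K^o) by apply: cont => //; exact: rn_fst_le.
have c2 : continuous (snd : H -> K^o) by apply: cont => //; exact: rn_snd_le.
have pr (g : H -> K^o) i : continuous g ->
    continuous ((fun x => g (x i)) : prod_topology (fun _ : 'I_2 => H) -> K^o).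
  by move=> cg x; apply: continuous_comp; [exact: proj_continuous | exact: cg].
move=> x; have Fx : Filter (nbhs x) by exact: nbhs_filter.
have h1 := cvgM (pr _ ord0 c1 x) (pr _ ord_max c1 x).
have h2 := cvgM (pr _ ord0 c2 x) (pr _ ord_max c2 x).
exact: cvgD (h1 Fx) (h2 Fx).
Qed.

Lemma dot_norm_le1 : (multilinear_norm re dot <= 1)%E.
Proof.
apply: ge_ereal_sup => _ [x x1 <-]; rewrite lee_fin -/(rn re _) /dot.
rewrite (le_trans (rnD hs _ _))// !(rnM hs) (le_trans (cauchy_schwarz2 _ _ _ _))//.
have r1 m : rn re (x m) <= 1 by have := x1 m; rewrite lee_fin.
by rewrite -!rn_euclid2 mulr_ile1 ?(rn_ge0 hs).
Qed.

Definition basis_seq (l : R) (j : nat) : H :=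
  if j == 0%N then (c l, 0) else if j == 1%N then (0, c l) else 0.

(** The sequence (l e_1, l e_2) is normalized by l^(2p) (1 + 2^(1 - p)) = 1, which
    makes its weak p-norm at most 1; its image (l^2, l^2, 0, ...) has p-norm
    (2 l^(2p))^(1/p) > 1. *)
Lemma not_stable (X : seq_rule) (p : R) : 1 < p ->
  (forall (G : completeNormedModType K) (x : nat -> G),
     seq_norm X x = weak_norm re p x) ->
  (forall (G : completeNormedModType K) (x : nat -> G),
     (forall j, (2 <= j)%N -> x j = 0) -> seq_mem X x) ->
  ~ multilinearly_stable re X.
Proof.
move=> p1 Xw Xmem /(_ 2%N (fun=> H) (scalar_space hs) dot isT).
move=> /(_ (conj dot_multilinear dot_continuous))[_ normE].
have p0 : 0 < p by rewrite (lt_trans _ p1).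
have pow1 (r : R) : 1 = 1 `^ r by rewrite powR1.
pose q : R := 1 + 2 `^ (1 - p).
have q0 : 0 < q by rewrite addr_gt0// powR_gt0.
have q2 : q < 2.
  rewrite /q -[2 in ltRHS](natrD _ 1 1) ltrD2l -opprB powRN invf_lt1 ?powR_gt0//.
  by rewrite [ltLHS](pow1 (p - 1)) gt0_ltr_powR ?subr_gt0 ?nnegrE ?ltr1n.
pose l : R := q `^ (- (2 * p)^-1).
have l0 : 0 <= l by exact: powR_ge0.
have lp : (l `^ p) ^+ 2 = q^-1.
  rewrite -powR_mulrn ?powR_ge0// -!powRrM -[q^-1]powR_inv1 ?(ltW q0)//; congr (_ `^ _).
  by field; rewrite gt_eqF.
pose x := basis_seq l.
have x1 : (weak_norm re p x <= 1)%E.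
  apply: ge_ereal_sup => _ [phi [_ phi1] <-].
  rewrite lp_norm_pair//; last by move=> [|[|j]]// _; rewrite linear0.
  rewrite lee_fin [leRHS](pow1 p^-1).
  rewrite ge0_ler_powR ?nnegrE ?addr_ge0 ?powR_ge0 ?invr_ge0 ?(ltW p0)//.
  have -> : x 0%N = c l *: ((1, 0) : H).
    by rewrite -[RHS]/((c l * 1, c l * 0) : H) mulr1 mulr0.
  have -> : x 1%N = c l *: ((0, 1) : H).
    by rewrite -[RHS]/((c l * 0, c l * 1) : H) mulr1 mulr0.
  rewrite !linearZ !(rnZc hs) (ger0_norm l0) !powRM ?(rn_ge0 hs)// -mulrDr.
  rewrite -(@expr_le1 _ 2)// ?mulr_ge0 ?addr_ge0 ?powR_ge0//.
  rewrite exprMn lp ler_pdivrMl// mulr1.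
  by apply: sum_powR_sqr_le; rewrite ?(rn_ge0 hs)//; exact: dual_norm_euclid2.
have out : (1 < weak_norm re p (Defs.induced dot (fun=> x)))%E.
  have idL : linear (id : scalar_space hs -> K^o) by [].
  pose il := GRing.isLinear.Build K (scalar_space hs) K^o *:%R id idL.
  pose iota : {linear scalar_space hs -> K^o} := HB.pack (id : scalar_space hs -> K^o) il.
  pose image (j : nat) : K^o := if (j < 2)%N then c l * c l else 0.
  have imageE : (fun j => iota (Defs.induced dot (fun=> x) j)) = image.
    apply/funext => -[|[|j]].
    - by rewrite -[LHS]/(c l * c l + 0 * 0 : K) mulr0 addr0.
    - by rewrite -[LHS]/(0 * 0 + c l * c l : K) mulr0 add0r.
    - by rewrite -[LHS]/(0 * 0 + 0 * 0 : K) !mulr0 addr0.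
  apply: (@lt_le_trans _ _ (lp_norm re p image)); last first.
    apply: ereal_sup_ubound; exists iota; last by rewrite imageE.
    split; first by move=> y; exact: cvg_id.
    by apply/(dual_norm_le1 hs) => y.
  have image0 j : (2 <= j)%N -> image j = 0 by rewrite /image leqNgt => /negbTE ->.
  rewrite (lp_norm_pair p0 image0) (rnM hs) (rn_c hs) (ger0_norm l0).
  have l2p : (l * l) `^ p = q^-1 by rewrite powRM// -expr2 lp.
  rewrite [X in X + X]l2p.
  rewrite lte_fin [ltLHS](pow1 p^-1).
  rewrite gt0_ltr_powR ?nnegrE ?invr_gt0 ?addr_ge0 ?invr_ge0 ?(ltW q0)//.
  by rewrite -[X in X + X]mulr1 -mulrDr ltr_pdivlMl// mulr1.
have : (induced_norm X dot <= 1)%E by rewrite normE; exact: dot_norm_le1.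
rewrite leNgt => /negP; apply; apply: (lt_le_trans out).
rewrite -Xw; apply: ereal_sup_ubound; exists (fun=> x) => // m.
by split; [apply: Xmem => -[|[|]] | rewrite Xw].
Qed.

Lemma pair_weakly_summable (p : R) (E : normedModType K) (x : nat -> E) : 0 < p ->
  (forall j, (2 <= j)%N -> x j = 0) -> weakly_summable re p x.
Proof.
move=> p0 x0 phi _; rewrite /in_lp lp_norm_pair ?ltry// => j j2.
by rewrite x0// linear0.
Qed.

Lemma lpw_not_stable p : 1 < p -> ~ multilinearly_stable re (lpw re p).
Proof.
move=> p1; apply: (not_stable p1) => // G x x0.
by apply: pair_weakly_summable => //; rewrite (lt_trans _ p1).
Qed.

Lemma lpu_not_stable p : 1 < p -> ~ multilinearly_stable re (lpu re p).
Proof.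
move=> p1; have p0 : 0 < p by rewrite (lt_trans _ p1).
apply: (not_stable p1) => // G x x0; apply: (lpu_eventually0 hs p0 x0).
exact: pair_weakly_summable.
Qed.

End Unstable.

(** * Multilinear stability of the weakly summable classes *)

Theorem theorem3p3 (R : realType) (K : numFieldType) (re : K -> R)
    (hK : scalar_field re) (p : R) (hp : 1 <= p) :
  (multilinearly_stable re (lpw re p) <-> p = 1) /\
  (multilinearly_stable re (lpu re p) <-> p = 1).
Proof.
have [c hs] := scalar_field_real_scalars hK.
split; split=> [stable|->].
- apply/eqP; rewrite eq_le hp andbT leNgt; apply/negP => p1.
  exact: (lpw_not_stable hs p1).
- exact: lpw1_stable hs.
- apply/eqP; rewrite eq_le hp andbT leNgt; apply/negP => p1.
  exact: (lpu_not_stable hs p1).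
- exact: lpu1_stable hs.
Qed.
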